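(* Let $k \subset \Bbbk \subset \mathbb{R}$ be subrings and let $(W,S)$ be a Coxeter system with $W$ finite. Let $V$ be a realization of $(W,S)$ over $\Bbbk$ on which $W$ acts faithfully, and suppose that $W$ preserves a $k$-orthant, spanned by the basis $X$. Let $\Gamma$ be the associated transposition graph. Then $W$ is a finite product of symmetric groups $W_C$ (including the trivial group $S_1$), one for each connected component $C$ of $\Gamma$. Moreover, $V \cong \bigoplus_C P_C \oplus Z$, where $P_C$ is the permutation representation of $W_C$ (inflated from this subgroup to $W$), and $Z$ is acted on trivially by $W$.
   Context: Realization: Let $\Bbbk$ be a commutative domain, $V$ a free $\Bbbk$-module, $V^* = \operatorname{Hom}_{\Bbbk}(V,\Bbbk)$, and $(W,S)$ a Coxeter system, with $m_{st}$ the order of $st$ in $W$. A realization of $(W,S)$ over $\Bbbk$ is the data of $V$ and, for each $s \in S$, of a simple root $\alpha_s \in V$ and a simple coroot $\alpha_s^\vee \in V^*$ such that (1) $\alpha_s^\vee(\alpha_s) = 2$; (2) for $s \neq t$, $\alpha_s^\vee(\alpha_t) = 0$ if and only if $m_{st} = 2$; (3) the assignment $s(v) := v - \alpha_s^\vee(v)\,\alpha_s$ defines a $\Bbbk$-linear action of $W$ on $V$. Orthants: For subrings $k \subset \Bbbk \subset \mathbb{R}$ set $k_+ = k \cap \mathbb{R}_{\ge 0}$. $W$ preserves a (full) $k$-lattice $\Lambda$ if $\Lambda$ is the $k$-span of some $\Bbbk$-basis of $V$ and $\Lambda$ is preserved by $W$. $W$ preserves a $k$-orthant if it preserves a $k$-lattice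 $\Lambda$ and there is a $k$-basis $X$ of $\Lambda$ such that $W$ preserves the $k_+$-span of $X$ (the orthant spanned by $X$). Transposition graph: In this situation, each $s \in S$ acting nontrivially on $V$ fixes all elements of $X$ except for exactly two; denote this pair of non-fixed elements by $X_s$. The transposition graph $\Gamma$ has vertex set $X$, and for each $s \in S$ acting nontrivially on $V$ an unoriented edge $e_s$ joining the two elements of $X_s$ (multiple edges allowed). For a connected component $C$ of $\Gamma$, $W_C$ is the parabolic subgroup of $W$ generated by the $s \in S$ whose edges $e_s$ lie in $C$ (trivial if $C$ is a single vertex). Permutation representation: the permutation representation of $S_n$ over $\Bbbk$ is the free $\Bbbk$-module with basis $x_1,\dots,x_n$ permuted by $S_n$. Here $W_C$ is identified with $S_n$, where $n$ is the number of vertices of $C$. Inflation from $W_C$ to $W$ is along the projection of the direct product $W$ onto its factor $W_C$. *)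

(* Defs.v *)
From HB Require Import structures.
From mathcomp Require Import all_boot all_order all_algebra all_fingroup.
From mathcomp Require Import finmap.
From mathcomp Require Import mathcomp_extra boolp classical_sets functions.
From mathcomp Require Import cardinality fsbigop reals.

Set Implicit Arguments.
Unset Strict Implicit.
Unset Printing Implicit Defensive.

Import Order.TTheory GRing.Theory Num.Theory.
Local Open Scope classical_set_scope.
Local Open Scope ring_scope.

(* Bourbaki's definition: the elements of S have order 2, they generate W, and
   the relations (s t)^(m_st) = 1, with m_st = #[s * t], present W.  As W is
   finite, no m_st is infinite. *)
Definition coxeter_system (W : finGroupType) (S : {set W}) : Prop :=
  [/\ {in S, forall s, #[s]%g = 2%N},
      <<S>>%g = [set: W]%SET
    & forall (H : groupType) (f : W -> H),
        {in S &, forall s t, ((f s * f t) ^+ #[s * t])%g = 1%g} ->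
        exists phi : W -> H,
          {morph phi : x y / (x * y)%g} /\ {in S, phi =1 f}].

Section Bases.
Variables (K : comNzRingType) (V : lmodType K).

(* The set P of allowed coefficients need not be a ring: it is K, a subring k
   of K, or the cone of nonnegative elements of k. *)
Definition lin_span (P : {pred K}) (B : set V) : set V :=
  [set v | exists (r : seq V) (c : V -> K),
     [/\ uniq r, forall x, x \in r -> B x /\ c x \in P
       & v = \sum_(x <- r) c x *: x]].

Definition independent (P : {pred K}) (B : set V) : Prop :=
  forall (r : seq V) (c : V -> K),
    uniq r -> (forall x, x \in r -> B x /\ c x \in P) ->
    \sum_(x <- r) c x *: x = 0 -> forall x, x \in r -> c x = 0.

Definition is_basis (P : {pred K}) (B L : set V) : Prop :=
  independent P B /\ lin_span P B = L.

End Bases.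

(* Group actions are on the right here, as everywhere in MathComp: the image of
   v under w is [to v w], with [to v (w * w') = to (to v w) w'], and the product
   s * t of permutations is "s, then t".  A left action is turned into a right
   one, and conversely, by w |-> w^-1, which fixes every simple reflection.
   Only the values of [simple_root] and [simple_coroot] on S are meaningful. *)
Record realization (K : comNzRingType) (W : finGroupType) (S : {set W})
    (V : lmodType K) := Realization {
  simple_root : W -> V;
  simple_coroot : W -> {scalar V};
  waction : {action W &-> V};
  _ : exists B : set V, is_basis predT B setT;
  _ : {in S, forall s, simple_coroot s (simple_root s) = 2};
  _ : {in S &, forall s t, s != t ->
        (simple_coroot s (simple_root t) = 0 <-> #[s * t]%g = 2%N)};
  _ : forall w, linear (fun v => waction v w);
  _ : {in S, forall s v, waction v s = v - simple_coroot s v *: simple_root s}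
}.

Definition faithful_action (W : finGroupType) (T : Type)
    (to : {action W &-> T}) : Prop :=
  forall w, (forall v, to v w = v) -> w = 1%g.

Definition preserves (W : finGroupType) (T : Type) (to : {action W &-> T})
    (A : set T) : Prop :=
  forall w v, A v -> A (to v w).

(* The base ring is the subring KK of the reals, as a type: [\val] is an
   injective ring morphism from K to R with image KK. *)
Section Orthants.
Variables (R : realType) (KK : {pred R}) (K : GRing.SubComNzRing.type KK).

Definition in_sub (k : {pred R}) : {pred K} := [pred a | \val a \in k].

Definition in_sub_nneg (k : {pred R}) : {pred K} :=
  [pred a | (\val a \in k) && (0 <= \val a)].

Variables (V : lmodType K) (W : finGroupType) (to : {action W &-> V}).

Definition preserves_lattice (k : {pred R}) (L : set V) : Prop :=
  (exists B, is_basis predT B setT /\ L = lin_span (in_sub k) B) /\ preserves to L.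

Definition preserves_orthant (k : {pred R}) (X : set V) : Prop :=
  exists L, [/\ preserves_lattice k L, is_basis (in_sub k) X L
              & preserves to (lin_span (in_sub_nneg k) X)].

End Orthants.

Section TranspositionGraph.
Variables (K : comNzRingType) (V : lmodType K) (W : finGroupType).
Variables (to : {action W &-> V}) (S : {set W}) (X : set V).

Definition nonfixed (s : W) : set V := X `&` [set x | to x s <> x].

Definition edge (s : W) (x y : V) : Prop :=
  [/\ s \in S, (exists v, to v s <> v), x <> y & nonfixed s = [set x; y]].

Definition adjacent : rel V := fun x y => `[< exists s, edge s x y >].

Definition components : set (set V) :=
  [set C | exists2 x, X x
         & C = [set y | exists2 p, path adjacent x p & last x p = y]].

(* The group W_C. *)
Definition comp_group (C : set V) : {group W} :=
  <<[set s | `[< exists x y, [/\ edge s x y, C x & C y] >]]%SET>>%G.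

(* The complement of the factor W_C in the product of all the W_D. *)
Definition other_comps_group (C : set V) : {group W} :=
  <<[set w | `[< exists D, [/\ components D, D <> C
                             & w \in comp_group D] >]]%SET>>%G.

(* When W is the direct product of the two groups, [divgr] is the projection
   onto the first one. *)
Definition comp_proj (C : set V) (w : W) : W :=
  divgr (comp_group C) (other_comps_group C) w.

End TranspositionGraph.

(* Junk value 0 if C is infinite. *)
Definition nverts (T : choiceType) (C : set T) : nat := #|` fset_set C|.

(* The direct sum of an arbitrary family of modules: families of finite
   support, with the pointwise operations. *)
Section DirectSum.
Variables (K : pzRingType) (I : Type) (M : I -> lmodType K).

Record dsum := DSum {
  dsum_fun :> forall i, M i;
  _ : `[< finite_set [set i | dsum_fun i <> 0] >] }.

HB.instance Definition _ := [isSub for dsum_fun].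
HB.instance Definition _ := gen_eqMixin dsum.
HB.instance Definition _ := gen_choiceMixin dsum.

Lemma dsumP (f g : dsum) : (forall i, f i = g i) -> f = g.
Proof. by move=> fg; apply: val_inj; apply: functional_extensionality_dep. Qed.

Lemma dsum_finite (f : dsum) : finite_set [set i | f i <> 0].
Proof. by case: f => f /= /asboolP. Qed.

Fact dsum_zero_subproof : `[< finite_set [set i | (0 : M i) <> 0] >].
Proof. by apply/asboolP; apply: (sub_finite_set _ (finite_set0 I)) => i /= /(_ erefl). Qed.
Definition dsum_zero := DSum dsum_zero_subproof.

Fact dsum_opp_subproof (f : dsum) : `[< finite_set [set i | - f i <> 0] >].
Proof.
apply/asboolP; apply: (sub_finite_set _ (dsum_finite f)) => i /= h e.
by apply: h; rewrite e oppr0.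
Qed.
Definition dsum_opp f := DSum (dsum_opp_subproof f).

Fact dsum_add_subproof (f g : dsum) :
  `[< finite_set [set i | f i + g i <> 0] >].
Proof.
apply/asboolP.
have fU : finite_set ([set i | f i <> 0] `|` [set i | g i <> 0]).
  by rewrite finite_setU; split; apply: dsum_finite.
apply: (sub_finite_set _ fU) => i /= h.
have [fi|fi] := pselect (f i = 0); last by left.
by right=> gi; apply: h; rewrite fi gi addr0.
Qed.
Definition dsum_add f g := DSum (dsum_add_subproof f g).

Fact dsum_scale_subproof (a : K) (f : dsum) :
  `[< finite_set [set i | a *: f i <> 0] >].
Proof.
apply/asboolP; apply: (sub_finite_set _ (dsum_finite f)) => i /= h e.
by apply: h; rewrite e scaler0.
Qed.
Definition dsum_scale a f := DSum (dsum_scale_subproof a f).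

Fact dsum_addA : associative dsum_add.
Proof. by move=> f g h; apply: dsumP => i /=; rewrite addrA. Qed.
Fact dsum_addC : commutative dsum_add.
Proof. by move=> f g; apply: dsumP => i /=; rewrite addrC. Qed.
Fact dsum_add0 : left_id dsum_zero dsum_add.
Proof. by move=> f; apply: dsumP => i /=; rewrite add0r. Qed.
Fact dsum_addN : left_inverse dsum_zero dsum_opp dsum_add.
Proof. by move=> f; apply: dsumP => i /=; rewrite addNr. Qed.

HB.instance Definition _ :=
  GRing.isZmodule.Build dsum dsum_addA dsum_addC dsum_add0 dsum_addN.

Fact dsum_scaleA (a b : K) (f : dsum) :
  dsum_scale a (dsum_scale b f) = dsum_scale (a * b) f.
Proof. by apply: dsumP => i /=; rewrite scalerA. Qed.
Fact dsum_scale1 : left_id 1 dsum_scale.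
Proof. by move=> f; apply: dsumP => i /=; rewrite scale1r. Qed.
Fact dsum_scaleDr : right_distributive dsum_scale +%R.
Proof. by move=> a f g; apply: dsumP => i /=; rewrite scalerDr. Qed.
Fact dsum_scaleDl (f : dsum) : {morph dsum_scale^~ f : a b / a + b}.
Proof. by move=> a b; apply: dsumP => i /=; rewrite scalerDl. Qed.

HB.instance Definition _ := GRing.Zmodule_isLmodule.Build K dsum
  dsum_scaleA dsum_scale1 dsum_scaleDr dsum_scaleDl.

End DirectSum.

(* Main.v *)
(* X is also a K-basis of V, and W permutes the rays spanned by X, because an
   invertible map preserving the cone permutes its extremal rays: w x = a y with
   a > 0 a unit.  As w has finite order, w x = a x forces a = 1, so X can be
   rescaled, orbit by orbit, to a basis that W permutes.  A reflection
   v |-> v - c(v) a moves at most two elements of this basis, as the differences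
   x - s x are all multiples of a.  Hence W is a faithful permutation group
   generated by transpositions: its orbits are the components of the graph,
   elements with disjoint supports commute, and the transpositions along a
   connected graph generate the symmetric group.  Since isolated vertices are
   components, the permutation modules exhaust V and the trivial summand can be
   taken to be 0. *)
Require Import Defs.
From HB Require Import structures.
From mathcomp Require Import all_boot all_order all_algebra all_fingroup.
From mathcomp Require Import finmap.
From mathcomp Require Import mathcomp_extra boolp classical_sets functions.
From mathcomp Require Import cardinality fsbigop reals.

Set Implicit Arguments.
Unset Strict Implicit.
Unset Printing Implicit Defensive.

Import Order.TTheory GRing.Theory Num.Theory.
Local Open Scope classical_set_scope.
Local Open Scope ring_scope.

(** * Coordinates on a basis *)

Section Coordinates.
Variables (K : comNzRingType) (V : lmodType K).
Implicit Types (P : {pred K}) (B X : set V) (c : V -> K) (v : V).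

(* Summing over every list that contains the support makes sums of
   combinations with different supports immediate. *)
Definition coordinates P B c v : Prop :=
  (forall x, c x \in P) /\
  exists r : seq V,
    [/\ forall x, x \in r -> B x, forall x, c x != 0 -> x \in r
      & forall s, uniq s -> {subset r <= s} -> v = \sum_(x <- s) c x *: x].

Lemma coordinatesW P Q B c v :
  {subset P <= Q} -> coordinates P B c v -> coordinates Q B c v.
Proof. by move=> PQ [cP cr]; split=> // x; apply: PQ. Qed.

Lemma lin_span_coordinates P B v :
  0 \in P -> lin_span P B v -> exists c, coordinates P B c v.
Proof.
move=> P0 [r [c [ur rB ->]]].
(* Off [r] the function [c] is arbitrary, so it is cut off to 0 there; hence the assumption
   [0 \in P]. *)
exists (fun x => if x \in r then c x else 0); split.
  by move=> x; case: ifP => // /rB[].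
exists r; split=> [x /rB[]//|x|s us rs]; first by case: ifP; rewrite ?eqxx.
under [RHS]eq_bigr do rewrite (fun_if (fun a => a *: _)) scale0r.
rewrite -big_mkcond -big_filter; apply: perm_big; apply: uniq_perm => //.
  exact: filter_uniq.
by move=> x; rewrite mem_filter; case: (boolP (x \in r)) => // /rs ->.
Qed.

(** Independence is applied to the difference of the two functions on the union of their lists,
    whence the closure of [P] under subtraction. *)
Lemma coordinates_unique P B c c' v :
  {in P &, forall a b, a - b \in P} -> independent P B ->
  coordinates P B c v -> coordinates P B c' v -> c =1 c'.
Proof.
move=> PB iB [cP [r [rB cr vE]]] [cP' [r' [rB' cr' vE']]] x.
pose s := undup (r ++ r').
have sE z : (z \in s) = (z \in r) || (z \in r') by rewrite mem_undup mem_cat.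
have [xs|xs] := boolP (x \in s); last first.
  move: xs; rewrite sE negb_or => /andP[xr xr'].
  transitivity (0 : K); first by apply/eqP; apply: contraNT xr => /cr.
  by apply/esym/eqP; apply: contraNT xr' => /cr'.
apply/eqP; rewrite -subr_eq0; apply/eqP.
apply: (iB s (fun z => c z - c' z)) xs => //; first exact: undup_uniq.
  by move=> z; rewrite sE => /orP[/rB|/rB'] Bz; split=> //; apply: PB.
under eq_bigr do rewrite scalerBl.
rewrite sumrB -vE ?undup_uniq -?vE' ?undup_uniq ?subrr // => z zr; rewrite sE zr //.
by rewrite orbT.
Qed.

Lemma coordinates_delta P B b :
  0 \in P -> 1 \in P -> B b -> coordinates P B (fun y => (y == b)%:R) b.
Proof.
move=> P0 P1 Bb; split=> [x|]; first by case: eqP.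
exists [:: b]; split=> [x /[1!inE]/eqP->//|x|s us sub].
  by rewrite inE; case: (x == b); rewrite // eqxx.
rewrite (bigD1_seq b) ?sub ?inE //= eqxx scale1r big1 ?addr0 // => i /negPf->.
by rewrite scale0r.
Qed.

(** Expansions can be substituted into one another; when the [v i] come from another basis, this
    multiplies by the transition matrix. *)
Lemma coordinates_sum P B (I : eqType) (s : seq I) (m : I -> K) (v : I -> V)
    (c : I -> V -> K) :
  0 \in P -> {in P &, forall a b, a + b \in P} ->
  {in P &, forall a b, a * b \in P} ->
  (forall i, i \in s -> m i \in P) ->
  (forall i, i \in s -> coordinates P B (c i) (v i)) ->
  coordinates P B (fun y => \sum_(i <- s) m i * c i y) (\sum_(i <- s) m i *: v i).
Proof.
move=> P0 PD PM; elim: s => [|i s IH] mP cv.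
  split=> [x|]; first by rewrite big_nil.
  exists [::]; split=> // [x|t _ _]; first by rewrite big_nil eqxx.
  by rewrite !big_nil big1 // => x _; rewrite big_nil scale0r.
have [||cP [r [rB cr vE]]] := IH.
- by move=> j js; apply: mP; rewrite inE js orbT.
- by move=> j js; apply: cv; rewrite inE js orbT.
have [ciP [ri [riB cri viE]]] := cv i (mem_head _ _).
split=> [x|].
  by rewrite big_cons; apply: PD => //; apply: PM => //; apply: mP; rewrite mem_head.
exists (ri ++ r); split=> [x|x|t ut sub].
- by rewrite mem_cat => /orP[/riB|/rB].
- rewrite big_cons mem_cat; apply: contraNT; rewrite negb_or => /andP[xri xr].
  have /eqP-> : c i x == 0 by apply: contraNT xri => /cri.
  by rewrite mulr0 add0r; apply: contraNT xr => /cr.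
rewrite big_cons [in LHS](viE t) //; last first.
  by move=> x xr; apply: sub; rewrite mem_cat xr.
rewrite (vE t) //; last by move=> x xr; apply: sub; rewrite mem_cat xr orbT.
rewrite scaler_sumr -big_split /=; apply: eq_bigr => x _.
by rewrite big_cons scalerDl scalerA.
Qed.

(** The functional [f y] reads off the coefficient of [y]. Coordinates are picked by choice, and
    their uniqueness makes the choice linear. *)
Lemma basis_coord X : is_basis predT X setT ->
  exists f : V -> V -> K,
    [/\ forall y, scalar (f y), forall v, coordinates predT X (f^~ v) v
      & forall x y, X x -> f y x = (y == x)%:R].
Proof.
move=> [iX sX].
have /choice[f fP] : forall v, exists c, coordinates predT X c v.
  by move=> v; apply: lin_span_coordinates; rewrite // sX.
have fU v c : coordinates predT X c v -> f v =1 c.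
  by move=> cv; apply: (@coordinates_unique predT X) cv.
exists (fun y v => f v y); split=> // [y a u v|x y Xx]; last first.
  by rewrite (fU _ _ (@coordinates_delta predT X x _ _ Xx)).
(* The vector [a *: u + v] is written as a sum over two booleans so that [coordinates_sum]
   applies. *)
have := @coordinates_sum predT X bool [:: true; false] (fun b => if b then a else 1)
  (fun b => if b then u else v) (fun b => if b then f u else f v).
rewrite !big_cons !big_nil scale1r addr0 => /(_ _ _ _ _ _)/fU -> //.
  by rewrite !big_cons big_nil mul1r addr0.
by move=> [].
Qed.

(** Both families span [L] over [P], so each expands on the other with coefficients in [P].
    Substituting these expansions shows that [X] spans [V] over [K]; it is independent because the
    product of the two transition matrices is the identity. *)
Lemma span_basis_basis P B X L :
  0 \in P -> 1 \in P -> {in P &, forall a b, a - b \in P} ->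
  {in P &, forall a b, a + b \in P} -> {in P &, forall a b, a * b \in P} ->
  is_basis predT B setT -> L = lin_span P B -> is_basis P X L ->
  is_basis predT X setT.
Proof.
move=> P0 P1 PB PD PM bB -> [iX sX].
have [f [fl fv _]] := basis_coord bB.
have sub b : B b -> lin_span P X b.
  move=> Bb; rewrite sX; exists [:: b], (fun=> 1); split=> // [x|].
    by rewrite inE => /eqP->.
  by rewrite big_seq1 scale1r.
have /choice[n nP] : forall b, exists c, B b -> coordinates P X c b.
  move=> b; have [/sub/(lin_span_coordinates P0)[c cb]|nB] := pselect (B b).
    by exists c.
  by exists (fun=> 0).
(* [f] holds the coefficients of X on B, and [n] those of B on X. *)
have fP x : X x -> coordinates P B (f^~ x) x.
  move=> Xx; have : lin_span P X x.
    exists [:: x], (fun=> 1); split=> // [y|]; first by rewrite inE => /eqP->.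
    by rewrite big_seq1 scale1r.
  rewrite sX => /(lin_span_coordinates P0)[c cx].
  suff -> : f^~ x = c by [].
  apply/funext; apply: (@coordinates_unique predT B) (fv x) _ => //; first by case: bB.
  exact: coordinatesW cx.
(* Both sides are coordinates of [x] on [X] with values in [P], the left one computed through [B],
   so uniqueness identifies them. *)
have fn x y s : X x -> uniq s -> (forall b, b \in s -> B b) ->
    (forall b, f b x != 0 -> b \in s) ->
    \sum_(b <- s) f b x * n b y = (y == x)%:R.
  move=> Xx us sB sf; have [fPx [r [rB fr xE]]] := fP x Xx.
  have xs : x = \sum_(b <- s) f b x *: b.
    rewrite [LHS](xE (undup (r ++ s))) ?undup_uniq //; last first.
      by move=> b br; rewrite mem_undup mem_cat br.
    rewrite (bigID (mem s)) /= [X in _ + X]big1 ?addr0 => [|b bs]; last first.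
      by have /eqP-> : f b x == 0; rewrite ?scale0r //; apply: contraNT bs => /sf.
    rewrite -big_filter; apply: perm_big; apply: uniq_perm => //.
      by rewrite filter_uniq ?undup_uniq.
    by move=> b; rewrite mem_filter mem_undup mem_cat; case: (b \in s); rewrite ?orbT.
  have := @coordinates_sum P X V s (f^~ x) id n P0 PD PM.
  rewrite -xs => cx.
  apply: (coordinates_unique PB iX (cx _ _) (coordinates_delta P0 P1 Xx) y).
    by move=> b _; apply: fPx.
  by move=> b /sB/nP.
split; last first.
  apply/seteqP; split=> // v _.
  have [_ [r [rB _ vE]]] := fv v.
  pose s := undup r.
  have {}vE : v = \sum_(b <- s) f b v *: b.
    by apply: vE; rewrite ?undup_uniq // => b; rewrite mem_undup.
  have := @coordinates_sum predT X V s (f^~ v) id n.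
  rewrite -vE => /(_ _ _ _ _ _)[]//.
    by move=> b; rewrite mem_undup => /rB/nP; apply: coordinatesW.
  move=> _ [t [tX _ tE]].
  exists (undup t), (fun y => \sum_(i <- s) f i v * n i y); split.
  - exact: undup_uniq.
  - by move=> x; rewrite mem_undup => /tX.
  - by apply: tE; rewrite ?undup_uniq // => b; rewrite mem_undup.
move=> r c ur rX r0 y yr.
have /choice[sup supP] : forall x, exists s : seq V, X x ->
    (forall b, b \in s -> B b) /\ (forall b, f b x != 0 -> b \in s).
  move=> x; have [/fP[_ [s [sB sf _]]]|nX] := pselect (X x); first by exists s.
  by exists [::].
pose s := undup (flatten (map sup r)).
have sB b : b \in s -> B b.
  by rewrite mem_undup => /flatten_mapP[x xr /(proj1 (supP x (rX x xr).1))].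
have sf x b : x \in r -> f b x != 0 -> b \in s.
  move=> xr /(proj2 (supP x (rX x xr).1)) bx; rewrite mem_undup.
  by apply/flatten_mapP; exists x.
(* The identity [fn] isolates [c y]; once the sums are exchanged, each inner sum is [f b] applied to
   the relation [r0], hence 0. *)
have -> : c y = \sum_(x <- r) c x * \sum_(b <- s) f b x * n b y.
  rewrite (bigD1_seq y) //= fn ?undup_uniq //; [|by case: (rX y yr)|by move=> b; apply: sf].
  rewrite eqxx mulr1 big_seq_cond big1 ?addr0 // => x /andP[xr xy].
  rewrite fn ?undup_uniq //; [|by case: (rX x xr)|by move=> b; apply: sf].
  by rewrite eq_sym (negPf xy) mulr0.
under eq_bigr do rewrite mulr_sumr.
rewrite exchange_big /= big1 // => b _.
under eq_bigr do rewrite mulrA.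
rewrite -mulr_suml.
have -> : \sum_(x <- r) c x * f b x = 0; last by rewrite mul0r.
pose g : {scalar V} := HB.pack (f b) (GRing.isLinear.Build _ _ _ _ (f b) (fl b)).
have /(congr1 g) := r0.
by rewrite linear_sum linear0 => {2}<-; apply: eq_bigr => x _; rewrite linearZ.
Qed.

End Coordinates.

(** * Rays *)

(* MathComp states these facts for actions on finite types only. *)
Section TotalActions.
Variables (W : finGroupType) (T : Type).

Lemma tactM (to : {action W &-> T}) x a b : to x (a * b)%g = to (to x a) b.
Proof. by case: to => act [] /= _ M; rewrite M ?inE. Qed.

Lemma tact_inj (to : {action W &-> T}) a x y : to x a = to y a -> x = y.
Proof. by case: to => act [inj M] /= /inj. Qed.

Lemma tact1 (to : {action W &-> T}) x : to x 1%g = x.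
Proof. by apply: (@tact_inj to 1%g); rewrite -tactM mulg1. Qed.

Lemma tactK (to : {action W &-> T}) w : cancel (to^~ w) (to^~ w^-1%g).
Proof. by move=> x; rewrite -tactM mulgV tact1. Qed.

Lemma tactKV (to : {action W &-> T}) w : cancel (to^~ w^-1%g) (to^~ w).
Proof. by move=> x; rewrite -tactM mulVg tact1. Qed.

Lemma total_is_action (act : T -> W -> T) :
  act^~ 1%g =1 id -> (forall x, act_morph act x) -> is_action [set: W]%SET act.
Proof.
move=> a1 aM; split=> [w x y e|x w w' _ _]; last exact: aM.
by rewrite -[x]a1 -(mulgV w) aM e -aM mulgV a1.
Qed.

End TotalActions.

Section Monomial.
Variables (R : realType) (KK : {pred R}) (K : GRing.SubComNzRing.type KK).
Variables (V : lmodType K) (X : set V) (f : V -> V -> K).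
Hypothesis f_linear : forall y, scalar (f y).
Hypothesis f_coordinates : forall v, coordinates predT X (f^~ v) v.
Hypothesis f_delta : forall x y, X x -> f y x = (y == x)%:R.
Variables (W : finGroupType) (to : {action W &-> V}).
Hypothesis to_linear : forall w, linear (to^~ w).
Hypothesis to_ge0 : forall w x y, X x -> 0 <= \val (f y (to x w)).

Let fL y : {scalar V} := HB.pack (f y) (GRing.isLinear.Build _ _ _ _ (f y) (f_linear y)).
Let toL w : {linear V -> V} :=
  HB.pack (to^~ w) (GRing.isLinear.Build _ _ _ _ (to^~ w) (to_linear w)).

Let toZ a v w : to (a *: v) w = a *: to v w.
Proof. exact: (linearZZ (toL w) _ _). Qed.

Let to_sum s (c : V -> K) w :
  to (\sum_(y <- s) c y *: y) w = \sum_(y <- s) c y *: to y w.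
Proof.
rewrite [LHS](linear_sum (toL w)); apply: eq_bigr => y _; exact: (linearZZ (toL w) _ _).
Qed.

Let fZ y a v : f y (a *: v) = a * f y v.
Proof. exact: (scalarZ (fL y)). Qed.

Let f_sum z s (c : V -> K) (g : V -> V) :
  f z (\sum_(y <- s) c y *: g y) = \sum_(y <- s) c y * f z (g y).
Proof. by rewrite [LHS](linear_sum (fL z)); apply: eq_bigr => y _; apply: fZ. Qed.

Let expand v : exists s,
  [/\ uniq s, forall y, y \in s -> X y & v = \sum_(y <- s) f y v *: y].
Proof.
have [_ [s [sX _ vE]]] := f_coordinates v.
exists (undup s); split=> [|y|]; first exact: undup_uniq.
  by rewrite mem_undup => /sX.
by apply: vE; rewrite ?undup_uniq // => y; rewrite mem_undup.
Qed.

Let f_inj u v : (forall y, X y -> f y u = f y v) -> u = v.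
Proof.
move=> uv; apply/eqP; rewrite -subr_eq0; apply/eqP.
have [s [_ sX ->]] := expand (u - v).
rewrite big_seq big1 // => y /sX Xy.
by rewrite -[f y _]/(fL y _) linearB /= uv // subrr scale0r.
Qed.

(** The witness [b] says that [a] is a unit of [K]; being nonnegative as well, [a] is positive. *)
Definition maps_ray w x y : Prop :=
  [/\ X x, X y & exists a b, [/\ 0 <= \val a, a * b = 1 & to x w = a *: y]].

(* Expanding x = (x w) w^-1 on X gives sums of nonnegative terms; if y occurs
   in x w, these force y w^-1 to be a multiple of x. *)
Lemma maps_ray_total w x : X x -> exists y, maps_ray w x y.
Proof.
move=> Xx; have [s [us sX xwE]] := expand (to x w).
have fx z : f z x = \sum_(y <- s) f y (to x w) * f z (to y w^-1%g).
  by rewrite -f_sum -to_sum -xwE tactK.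
have [y ys ay] : exists2 y, y \in s & f y (to x w) != 0.
  apply: contrapT => no.
  suff /eqP : f x x = 0 by rewrite f_delta // eqxx oner_eq0.
  rewrite fx big_seq big1 // => y ys.
  have [->|a0] := eqVneq (f y (to x w)) 0; first by rewrite mul0r.
  by case: no; exists y.
have b0 z : z != x -> f z (to y w^-1%g) = 0.
  move=> zx; have /esym := fx z; rewrite f_delta // (negPf zx).
  move=> /(congr1 \val); rewrite rmorph0 rmorph_sum big_seq => /eqP.
  rewrite psumr_eq0 => [|t /sX Xt]; last by rewrite rmorphM mulr_ge0 ?to_ge0.
  move=> /allP/(_ y ys); rewrite ys rmorphM mulf_eq0 => /orP[|]/eqP e.
    by case/eqP: ay; apply: val_inj; rewrite e rmorph0.
  by apply: val_inj; rewrite e rmorph0.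
set a := f y (to x w); pose b := f x (to y w^-1%g).
have Xy := sX y ys.
have yb : to y w^-1%g = b *: x.
  apply: f_inj => z Xz; rewrite fZ (f_delta z Xx).
  by have [->|/b0->] := eqVneq z x; rewrite ?mulr1 ?mulr0.
have {yb}yE : y = b *: to x w by rewrite -toZ -yb tactKV.
have ba : b * a = 1 by rewrite -fZ -yE f_delta // eqxx.
exists y; split=> //; exists a, b; split; rewrite ?to_ge0 // 1?mulrC //.
(* Away from [y] the coordinates of [to x w] vanish, because the unit [b] turns them into those of
   [y]. *)
apply: f_inj => z Xz; rewrite fZ (f_delta z Xy).
have [->|zy] := eqVneq z y; rewrite ?mulr1 // mulr0.
by rewrite -[LHS]mul1r -ba mulrAC -(fZ z b) -yE f_delta // (negPf zy) mul0r.
Qed.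

Lemma maps_ray_inj w x y z : maps_ray w x y -> maps_ray w x z -> y = z.
Proof.
move=> [_ Xy [a [b [_ ab e]]]] [_ Xz [a' [b' [_ _ e']]]].
apply/eqP; apply: contraT => yz.
have /(congr1 (f y)) := e; rewrite e' !fZ !f_delta // eqxx (negPf yz) mulr0 mulr1.
by move=> a0; move/eqP: ab; rewrite -a0 mul0r eq_sym oner_eq0.
Qed.

Lemma maps_ray1 x : X x -> maps_ray 1%g x x.
Proof.
by move=> Xx; split=> //; exists 1, 1; rewrite tact1 scale1r mulr1 rmorph1 ler01.
Qed.

Lemma maps_rayM w w' x y z :
  maps_ray w x y -> maps_ray w' y z -> maps_ray (w * w')%g x z.
Proof.
move=> [Xx Xy [a [b [a0 ab e]]]] [_ Xz [a' [b' [a0' ab' e']]]].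
split=> //; exists (a * a'), (b * b'); rewrite rmorphM mulr_ge0 //.
by rewrite mulrACA ab ab' mulr1 tactM e toZ e' scalerA.
Qed.

Lemma maps_rayV w x y : maps_ray w x y -> maps_ray w^-1%g y x.
Proof.
move=> [Xx Xy [a [b [a0 ab e]]]]; split=> //; exists b, a; split.
(* Nonnegativity of [b] comes from [b = a * (b * b)]. *)
- by rewrite -[b]mul1r -ab mulrC -mulrCA !rmorphM mulr_ge0 // -expr2 sqr_ge0.
- by rewrite mulrC.
by rewrite -[x](tactK to w) e toZ scalerA mulrC ab scale1r.
Qed.

(** Powers of [w] scale [x] by powers of [a], so [a] is a root of unity, and 1 is the only
    nonnegative real one. *)
Lemma maps_ray_fixed w x : maps_ray w x x -> to x w = x.
Proof.
move=> [Xx _ [a [_ [a0 _ e]]]].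
have pow n : to x (w ^+ n)%g = a ^+ n *: x.
  elim: n => [|n IH]; first by rewrite tact1 scale1r.
  by rewrite expgSr tactM IH toZ e scalerA -exprSr.
have := pow #[w]%g; rewrite expg_order tact1 => /(congr1 (f x)).
rewrite fZ f_delta // eqxx mulr1 => /(congr1 \val)/esym/eqP.
rewrite rmorphXn rmorph1 pexpr_eq1 // => /eqP a1.
by rewrite e (_ : a = 1) ?scale1r //; apply: val_inj; rewrite a1 rmorph1.
Qed.

(* r x is the image of a base point of the orbit of x; by maps_ray_fixed it does
   not depend on the group element that moves the base point to the ray of x. *)
Lemma permuted_basis : exists (p : {action W &-> V}) (r : V -> V) (g : V -> V -> K),
  [/\ forall w x, X x -> X (p x w) /\ (p x w = x <-> to x w = x),
      forall w x, ~ X x -> p x w = x,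
      forall w x, X x -> to (r x) w = r (p x w)
    & [/\ forall y, scalar (g y),
          forall x y, X x -> X y -> g y (r x) = (y == x)%:R
        & forall v, exists s, [/\ uniq s, forall y, y \in s -> X y
            & v = \sum_(y <- s) g y v *: r y]]].
Proof.
(* The action [p] follows the rays of [X] and is extended by the identity, so that it acts on all of
   [V]. *)
have /choice[q qP] : forall z : W * V, exists y, if `[< X z.2 >] then maps_ray z.1 z.2 y
    else y = z.2.
  by move=> [w x] /=; case: asboolP => [/maps_ray_total|_]; last exists x.
pose p0 x w := q (w, x).
have pX w x : X x -> maps_ray w x (p0 x w).
  by move=> Xx; have := qP (w, x); rewrite /= asboolT.
have pE w x y : maps_ray w x y -> p0 x w = y.
  by move=> h; apply: (maps_ray_inj (pX w x _) h); case: h.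
have pnX w x : ~ X x -> p0 x w = x.
  by move=> nX; have := qP (w, x); rewrite /= asboolF.
have p1 : p0^~ 1%g =1 id.
  by move=> x; have [/maps_ray1/pE|/pnX] := pselect (X x).
have pM : forall x, act_morph p0 x.
  move=> x w w'; have [Xx|nX] := pselect (X x); last by rewrite !pnX // pnX.
  apply: pE; apply: (maps_rayM (pX _ _ Xx) (pX _ _ _)).
  by case: (pX w x Xx).
pose p := Action (total_is_action p1 pM).
(* The value of [xget] depends on the set alone, so all rays of one orbit get the same base point.
   The default 0 occurs only outside [X]. *)
pose base x := xget 0 [set y | exists w, maps_ray w y x].
have baseP x : X x -> exists w, maps_ray w (base x) x.
  move=> Xx; rewrite /base; case: xgetP => [y _ //|/(_ x)[]].
  by exists 1%g; apply: maps_ray1.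
have base_eq w x y : maps_ray w x y -> base x = base y.
  move=> xy; congr (xget 0); apply/seteqP; split=> z [w' h].
    by exists (w' * w)%g; apply: (maps_rayM h xy).
  by exists (w' * w^-1)%g; apply: (maps_rayM h (maps_rayV xy)).
have /choice[h hP] : forall x, exists w, X x -> maps_ray w (base x) x.
  move=> x; have [/baseP[w ?]|nX] := pselect (X x); first by exists w.
  by exists 1%g.
pose r x := to (base x) (h x).
have /choice[u uP] : forall x, exists ab : K * K, X x ->
    ab.1 * ab.2 = 1 /\ r x = ab.1 *: x.
  move=> x; have [/hP[_ _ [a [b [_ ab e]]]]|nX] := pselect (X x).
    by exists (a, b).
  by exists (0, 0).
(* As [r y] is [(u y).1 *: y], the coordinates dual to [r] arise from [f] through the inverse factor
   [(u y).2]. *)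
exists p, r, (fun y v => (u y).2 * f y v); split=> [w x Xx|||].
- split; first by case: (pX w x Xx).
  split=> [e|e]; first by apply: maps_ray_fixed; rewrite -{2}e; apply: pX.
  apply: pE; split=> //; exists 1, 1.
  by rewrite scale1r mulr1 rmorph1 ler01.
- by move=> w x /pnX.
- move=> w x Xx; have xy := pX w x Xx; rewrite /r -/(p0 x w) -tactM.
  apply: (canRL (tactKV to _)); rewrite -tactM -(base_eq w x (p0 x w)) //.
  apply: maps_ray_fixed; apply: (maps_rayM (maps_rayM (hP x Xx) xy)).
  rewrite (base_eq _ _ _ xy); apply: maps_rayV; apply: hP.
  by case: xy.
split.
- by move=> y a v v'; rewrite f_linear mulrDr mulrCA.
- move=> x y Xx Xy; have [uu ->] := uP x Xx; rewrite fZ f_delta //.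
  have [->|] := eqVneq; last by rewrite !mulr0.
  by rewrite mulr1 mulrC.
move=> v; have [s [us sX vE]] := expand v; exists s; split=> //.
rewrite [LHS]vE !big_seq; apply: eq_bigr => y /sX/uP[uu ->].
by rewrite scalerA mulrAC [_.2 * _]mulrC uu mul1r.
Qed.

End Monomial.

(** * Reflections *)

Section PermutedBasisReflection.
Variables (K : comNzRingType) (V : lmodType K) (X : set V).
Variables (W : finGroupType) (to p : {action W &-> V}) (r : V -> V).
Variable (g : V -> V -> K).
Hypothesis to_linear : forall w, linear (to^~ w).
Hypothesis pX : forall w x, X x -> X (p x w).
Hypothesis to_r : forall w x, X x -> to (r x) w = r (p x w).
Hypothesis g_linear : forall y, scalar (g y).
Hypothesis g_delta : forall x y, X x -> X y -> g y (r x) = (y == x)%:R.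
Hypothesis expand : forall v, exists s,
  [/\ uniq s, forall y, y \in s -> X y & v = \sum_(y <- s) g y v *: r y].

Lemma eq_linear_on_basis (U : lmodType K) (f h : {linear V -> U}) :
  (forall x, X x -> f (r x) = h (r x)) -> f =1 h.
Proof.
move=> fh v; have [s [_ sX ->]] := expand v.
rewrite !linear_sum !big_seq; apply: eq_bigr => y /sX Xy.
by rewrite !linearZZ fh.
Qed.

Lemma fixes_basis_trivial w : (forall x, X x -> p x w = x) -> forall v, to v w = v.
Proof.
move=> h v; pose f : {linear V -> V} :=
  HB.pack (to^~ w) (GRing.isLinear.Build _ _ _ _ (to^~ w) (to_linear w)).
by apply: (eq_linear_on_basis (f := f) (h := idfun)) => x Xx; rewrite /= to_r // h.
Qed.

(** Coordinates travel with the permuted basis vectors; this becomes the permutation matrix acting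
    on rows of coordinates. *)
Lemma basis_coord_act w x v : X x -> g (p x w) (to v w) = g x v.
Proof.
move=> Xx; pose gL y : {scalar V} :=
  HB.pack (g y) (GRing.isLinear.Build _ _ _ _ (g y) (g_linear y)).
pose f : {linear V -> V} :=
  HB.pack (to^~ w) (GRing.isLinear.Build _ _ _ _ (to^~ w) (to_linear w)).
have [s [_ sX ->]] := expand v.
rewrite -[to _ w]/(f _) -[g _ _]/(gL _ _) -[RHS]/(gL _ _) !linear_sum !big_seq.
apply: eq_bigr => y /sX Xy; rewrite linearZZ !scalarZ /= to_r // !g_delta //; try exact: pX.
by rewrite (inj_eq (@tact_inj _ _ p w)).
Qed.

(** The vectors [r u - r (p u s)] are all multiples of [a], hence proportional, whereas differences
    of disjoint pairs of basis vectors are independent. *)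
Lemma reflection_transposes s a (c : V -> K) :
  #[s]%g = 2%N -> (exists v, to v s <> v) -> (forall v, to v s = v - c v *: a) ->
  exists x y, [/\ X x, X y, x <> y & X `&` [set z | p z s <> z] = [set x; y]].
Proof.
move=> s2 nt sE.
have ss z : p (p z s) s = z.
  by rewrite -tactM -[(s * s)%g]/(s ^+ 2)%g -s2 expg_order tact1.
have [x [Xx nx]] : exists x, X x /\ p x s <> x.
  apply: contrapT => no; have [v []] := nt; apply: fixes_basis_trivial => x Xx.
  by apply: contrapT => nx; apply: no; exists x.
have Xy : X (p x s) by apply: pX.
exists x, (p x s); split=> // [|]; first by move/esym.
apply/seteqP; split=> [z [/= Xz nz]|z [->|->]] /=; last 2 first.
- by split.
- by split=> // e; apply/nx/(@tact_inj _ _ p s).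
apply: contrapT => /not_orP[zx zy].
have Xpz : X (p z s) by apply: pX.
have pzx : p z s <> x by move=> e; apply: zy; rewrite -e ss.
have e u : X u -> c (r u) *: a = r u - r (p u s).
  by move=> Xu; rewrite -to_r // sE opprB addrC subrK.
pose gL y : {scalar V} :=
  HB.pack (g y) (GRing.isLinear.Build _ _ _ _ (g y) (g_linear y)).
have gB y u v : X u -> X v -> X y -> g y (r u - r v) = (y == u)%:R - (y == v)%:R.
  by move=> Xu Xv Xw; rewrite -(g_delta Xu) // -(g_delta Xv) //; exact: (linearB (gL y)).
have neqF (u v : V) : u <> v -> (u == v) = false by move=> /eqP/negPf.
have gZ y b v : g y (b *: v) = b * g y v by exact: (scalarZ (gL y)).
(* Both sides equal [(c (r z) * c (r x)) *: a]. The coordinate at [x] gives [c (r z) = 0], so [r z]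
   and [r (p z s)] coincide, which the coordinate at [z] refutes. *)
have : c (r z) *: (r x - r (p x s)) = c (r x) *: (r z - r (p z s)).
  by rewrite -!e // !scalerA mulrC.
move=> /(congr1 (g x)); rewrite !gZ !gB // eqxx !neqF //; try exact/nesym.
rewrite subrr mulr0 subr0 mulr1 => cz0.
have /(congr1 (g z)) := e z Xz; rewrite cz0 scale0r gB // eqxx neqF; last exact/nesym.
by rewrite -[g z 0]/(gL z 0) linear0 subr0 => /esym/eqP; rewrite oner_eq0.
Qed.
End PermutedBasisReflection.

(** * Groups generated by transpositions *)

(** In a finite group a subset that contains 1 and is closed under products is a subgroup, so
    inverses require no case. *)
Lemma gen_ind (W : finGroupType) (A : {set W}) (Q : W -> Prop) :
  Q 1%g -> (forall a b, Q a -> Q b -> Q (a * b)%g) -> {in A, forall a, Q a} ->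
  {in <<A>>%g, forall a, Q a}.
Proof.
move=> Q1 QM QA w.
have gQ : group_set [set a : W | `[< Q a >]]%SET.
  apply/group_setP; split=> [|a b]; rewrite !inE //; exact: QM.
have GE a : (a \in Group gQ) = `[< Q a >] by rewrite finset.in_set.
have /fintype.subsetP/(_ w) : <<A>>%g \subset Group gQ.
  by rewrite gen_subG; apply/fintype.subsetP=> a /QA Qa; rewrite GE; apply/asboolP.
by move=> h /h; rewrite GE => /asboolP.
Qed.

Section FaithfulPermutations.
Variables (W : finGroupType) (T : Type) (p : {action W &-> T}).
Hypothesis p_faithful : faithful_action p.

Lemma faithful_eq a b : (forall x, p x a = p x b) -> a = b.
Proof.
move=> ab; apply/eqP; rewrite eq_mulgV1; apply/eqP; apply: p_faithful => x.
by rewrite tactM ab tactK.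
Qed.

(** By injectivity [a] maps [A] into itself and [b] maps the complement into itself, so at each
    point only one of the two acts. *)
Lemma disjoint_support_commute (A : set T) a b :
  (forall x, ~ A x -> p x a = x) -> (forall x, A x -> p x b = x) -> commute a b.
Proof.
move=> aA bA; apply: faithful_eq => x; rewrite !tactM.
have [Ax|nAx] := pselect (A x).
  rewrite [in RHS]bA // bA //; apply: contrapT => nA.
  by have e := tact_inj (aA _ nA); apply: nA; rewrite e.
rewrite [p x a]aA // aA // => Ab.
by have e := tact_inj (bA _ Ab); apply: nAx; rewrite -e.
Qed.

End FaithfulPermutations.

Lemma tperm_generate n (G : {group 'S_n}) :
  (forall i j, tperm i j \in G) -> [set: 'S_n]%SET \subset G.
Proof.
move=> GT; apply/fintype.subsetP => s _; have [ts -> _] := prod_tpermP s.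
by apply: group_prod => t _; apply: GT.
Qed.

Lemma nverts_enum (T : choiceType) (C : set T) :
  finite_set C -> exists x : 'I_(nverts C) -> T, set_bij setT C x.
Proof.
move=> fC; exists (tnth (in_tuple (enum_fset (fset_set C)))); split.
- move=> i _; have := mem_tnth i (in_tuple (enum_fset (fset_set C))).
  by rewrite (in_fset_set fC) inE.
- have /tuple_uniqP xI : uniq (in_tuple (enum_fset (fset_set C))) by exact: fset_uniq.
  by move=> i j _ _ /xI.
move=> z Cz; have : z \in in_tuple (enum_fset (fset_set C)).
  by rewrite [_ \in _](in_fset_set fC) inE.
by move/tnthP => [i ->]; exists i.
Qed.

Section TranspositionGroups.
Variables (K : comNzRingType) (V : lmodType K) (W : finGroupType).
Variables (to p : {action W &-> V}) (S : {set W}) (X : set V).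
Hypothesis pX : forall w x, X x -> X (p x w).
Hypothesis p_fix : forall w x, X x -> (p x w = x <-> to x w = x).
Hypothesis p_out : forall w x, ~ X x -> p x w = x.
Hypothesis p_faithful : faithful_action p.
Hypothesis S_transposes : {in S, forall s, exists x y,
  [/\ X x, X y, x <> y & X `&` [set z | p z s <> z] = [set x; y]]}.
Hypothesis S_gen : <<S>>%g = [set: W]%SET.

Local Notation edge := (edge to S X).
Local Notation adjacent := (adjacent to S X).
Local Notation comps := (components to S X).
Local Notation W_ := (comp_group to S X).
Local Notation other := (other_comps_group to S X).

(** The graph is defined through [to]; since [to] and [p] fix the same elements of [X], it can be
    read off the permutations [p]. *)
Let nonfixedE s : nonfixed to X s = X `&` [set z | p z s <> z].
Proof.
by apply/seteqP; split=> z [Xz /= nz]; split=> //= h; apply: nz; apply/(p_fix s Xz).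
Qed.

Lemma edgeP s x y : edge s x y ->
  [/\ X x, X y, p x s = y, p y s = x & forall z, z <> x -> z <> y -> p z s = z].
Proof.
move=> [_ _ xy]; rewrite nonfixedE => e.
have ez z : X z /\ p z s <> z <-> z = x \/ z = y.
  by move/seteqP: e => [h h']; split=> [/h|/h'].
have [Xx nx] := (ez x).2 (or_introl erefl).
have [Xy ny] := (ez y).2 (or_intror erefl).
split=> //.
(* The image of a moved vertex is moved too and differs from that vertex, so it is the other end of
   the edge. *)
- have : X (p x s) /\ p (p x s) s <> p x s by split; [apply: pX|move=> /(@tact_inj _ _ p)].
  by move/ez => [].
- have : X (p y s) /\ p (p y s) s <> p y s by split; [apply: pX|move=> /(@tact_inj _ _ p)].
  by move/ez => [].
move=> z zx zy; have [Xz|/p_out//] := pselect (X z).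
by apply: contrapT => nz; have [] := (ez z).1 (conj Xz nz).
Qed.

Lemma edge_sym s x y : edge s x y -> edge s y x.
Proof. by move=> [sS nt xy e]; split=> //; [move/esym|rewrite setUC]. Qed.

Lemma edge_moved s x : s \in S -> X x -> p x s <> x -> edge s x (p x s).
Proof.
move=> sS Xx nx; have [u [v [Xu Xv uv uvE]]] := S_transposes sS.
have e : edge s u v.
  split=> //; last by rewrite nonfixedE.
  exists x; move/(p_fix s Xx).2; exact: nx.
have [_ _ us vs h] := edgeP e.
have [xu|xu] := pselect (x = u); first by rewrite xu us.
have [xv|xv] := pselect (x = v); first by rewrite xv vs; apply: edge_sym.
by case: nx; apply: h.
Qed.

Lemma S_edge s : s \in S -> exists x y, edge s x y.
Proof.
move=> sS; have [x [y [_ _ xy e]]] := S_transposes sS; exists x, y.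
have [Xx nx] : (X `&` [set z | p z s <> z]) x by rewrite e; left.
split=> //; last by rewrite nonfixedE.
by exists x; move/(p_fix s Xx).2; apply: nx.
Qed.

Lemma adjacentP x y : reflect (exists s, edge s x y) (adjacent x y).
Proof. exact: asboolP. Qed.

Lemma adjacent_sym : symmetric adjacent.
Proof. by move=> x y; apply/adjacentP/adjacentP=> -[s /edge_sym]; exists s. Qed.

Let conn x : set V := [set y | exists2 q, path adjacent x q & last x q = y].

Let conn_refl x : conn x x. Proof. by exists [::]. Qed.

Let conn_trans x y z : conn x y -> conn y z -> conn x z.
Proof.
move=> [q qP <-] [q' qP' <-]; exists (q ++ q'); rewrite ?last_cat //.
by rewrite cat_path qP.
Qed.

Let conn_sym x y : conn x y -> conn y x.
Proof.
move=> [q qP <-]; exists (rev (belast x q)).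
  by rewrite rev_path; apply: sub_path qP => u v; rewrite adjacent_sym.
by case: q qP => //= z q _; rewrite rev_cons last_rcons.
Qed.

Lemma comps_sub C x : comps C -> C x -> X x.
Proof.
move=> [y Xy ->] [q qP <-]; elim: q y Xy qP => //= z q IH y _.
by move=> /andP[/adjacentP[s /edgeP[_ Xz _ _ _]]]; apply: IH.
Qed.

Lemma compsE C x : comps C -> C x -> C = conn x.
Proof.
move=> [y _ ->] yx; apply/seteqP; split=> z; last exact: conn_trans.
by apply: conn_trans; apply: conn_sym.
Qed.

Lemma comps_eq C D x : comps C -> comps D -> C x -> D x -> C = D.
Proof. by move=> cC cD Cx Dx; rewrite (compsE cC Cx) (compsE cD Dx). Qed.

Lemma comps_cover x : X x -> exists2 C, comps C & C x.
Proof. by move=> Xx; exists (conn x) => //; exists x. Qed.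

Lemma comps_edge C s x y : comps C -> edge s x y -> C x -> C y.
Proof.
move=> cC e Cx; rewrite (compsE cC Cx); exists [:: y] => //=.
by rewrite andbT; apply/adjacentP; exists s.
Qed.

Lemma comps_stable C w x : comps C -> C x -> C (p x w).
Proof.
move=> cC Cx; have wS : w \in <<S>>%g by rewrite S_gen inE.
move: w wS x Cx; apply: (@gen_ind _ _ (fun w => forall x, C x -> C (p x w))) => [x|a b Ca Cb x|s sS x Cx].
- by rewrite tact1.
- by rewrite tactM => /Ca/Cb.
have [->//|nx] := pselect (p x s = x).
exact: comps_edge cC (edge_moved sS (comps_sub cC Cx) nx) Cx.
Qed.

(** Neighbours differ by a generator, so a component lies inside an orbit of the finite group
    [W]. *)
Lemma comps_finite C : comps C -> finite_set C.
Proof.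
move=> [x Xx ->]; apply: (@sub_finite_set _ _ (p x @` [set: W])); last first.
  exact/finite_image/finite_finset.
(* For the induction on the path, its start is generalized from [x] to [p x w], with [w = 1]
   initially. *)
move=> _ [q qP <-] /=; rewrite -[x in last x _](tact1 p).
rewrite -[x in path _ x _](tact1 p) in qP; elim: q 1%g qP => [|z q IH] w /=.
  by exists w.
move=> /andP[/adjacentP[s /edgeP[_ _ <- _ _]]]; rewrite -tactM; exact: IH.
Qed.

Lemma comp_group_fix C w x : w \in W_ C -> ~ C x -> p x w = x.
Proof.
move=> wC; move: w wC x; apply: (@gen_ind _ _ (fun w => forall x, ~ C x -> p x w = x)) => [x|a b Ca Cb x nC|s].
- by rewrite tact1.
- by rewrite tactM Ca // Cb.
rewrite finset.in_set => /asboolP[u [v [/edgeP[_ _ _ _ h] Cu Cv]]] x nC.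
by apply: h => e; apply: nC; rewrite e.
Qed.

Lemma other_comps_fix C w x : comps C -> w \in other C -> C x -> p x w = x.
Proof.
move=> cC wC; move: w wC x.
apply: (@gen_ind _ _ (fun w => forall x, C x -> p x w = x)) => [x|a b Ca Cb x Cx|w].
- by rewrite tact1.
- by rewrite tactM Ca // Cb.
rewrite finset.in_set => /asboolP[D [cD DC wD]] x Cx; apply: (comp_group_fix wD) => Dx.
exact/DC/(comps_eq cD cC Dx Cx).
Qed.

Lemma edge_comp_group C s x y : comps C -> edge s x y -> C x -> s \in W_ C.
Proof.
move=> cC e Cx; apply: mem_gen; rewrite finset.in_set; apply/asboolP; exists x, y.
by split=> //; apply: comps_edge e Cx.
Qed.

Lemma S_comp_group s : s \in S -> exists2 C, comps C & s \in W_ C.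
Proof.
move=> /S_edge[x [y e]]; have [Xx _ _ _ _] := edgeP e.
by have [C cC Cx] := comps_cover Xx; exists C => //; apply: edge_comp_group e Cx.
Qed.

(** The two factors commute by disjointness of supports, so their product is a subgroup; each
    generator lies in one of them. *)
Lemma comp_mul_other C w : comps C -> w \in (W_ C * other C)%g.
Proof.
move=> cC; rewrite -cent_joinEr; last first.
  apply/fintype.subsetP => b bo; apply/centP => a aC; apply/commute_sym.
  apply: (disjoint_support_commute p_faithful (A := C)) => x.
    exact: comp_group_fix.
  exact: other_comps_fix.
have : w \in <<S>>%g by rewrite S_gen inE.
apply: (fintype.subsetP _ w); rewrite gen_subG; apply/fintype.subsetP => s sS.
have [D cD sD] := S_comp_group sS.
have [DC|DC] := pselect (D = C).
  by apply: (fintype.subsetP (joing_subl _ _)); rewrite -DC.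
apply: (fintype.subsetP (joing_subr _ _)); apply: mem_gen; rewrite finset.in_set.
by apply/asboolP; exists D.
Qed.

(** In the factorization of [w], the second factor fixes [C] pointwise, and the first one keeps [C]
    stable. *)
Lemma comp_projP C w : comps C ->
  comp_proj to S X C w \in W_ C /\
  forall x, C x -> p x (comp_proj to S X C w) = p x w.
Proof.
move=> cC; have wC := comp_mul_other w cC.
have pC := mem_divgr wC; split=> // x Cx.
rewrite [in RHS](divgr_eq (W_ C) (other C) w) [RHS]tactM.
by apply/esym/(other_comps_fix cC (mem_remgr wC)); apply: comps_stable.
Qed.

(** [X] may be infinite, but a nontrivial [W_ C] has a generator with its edge in [C], and that
    generator determines [C]. *)
Lemma finite_nontrivial_comps : finite_set [set C | comps C /\ W_ C <> 1%G].
Proof.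
have /choice[F FP] : forall s : W, exists C, forall D x y,
    comps D -> edge s x y -> D x -> C = D.
  move=> s; have [[C [x [y [cC e Cx]]]]|no] :=
    pselect (exists C x y, [/\ comps C, edge s x y & C x]); last first.
    by exists set0 => D x y cD e Dx; case: no; exists D, x, y.
  exists C => D x' y' cD e' Dx'.
  have [xx|nxx] := pselect (x' = x).
    by apply: (comps_eq cC cD _ Dx'); rewrite xx.
  apply: (comps_eq cC cD _ Dx').
  have [_ _ x's _ _] := edgeP e'; have [_ _ xs _ h] := edgeP e.
  have [->|nxy] := pselect (x' = y); first exact: comps_edge e Cx.
  by case: e' => _ _ /(_ _)[]; rewrite -x's h.
apply: (@sub_finite_set _ _ (F @` [set: W])); last exact/finite_image/finite_finset.
move=> C [cC nt] /=; apply: contrapT => nF; apply: nt; apply/trivGP.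
rewrite gen_subG; apply/fintype.subsetP => s; rewrite finset.in_set => /asboolP[x [y [e Cx _]]].
by case: nF; exists s => //; apply: FP e Cx.
Qed.

(** Equality with a group says that the product is direct, as [dprod] is otherwise empty. The last
    clause carries the induction: the product of the tail fixes [C] pointwise, so it commutes with
    [W_ C] and, by faithfulness, meets it trivially. *)
Lemma bigdprod_comps (s : seq (set V)) : uniq s -> {in s, forall C, comps C} ->
  exists G : {group W},
    [/\ \big[dprod/1%g]_(C <- s) (W_ C : {set W}) = G,
        {in s, forall C, W_ C \subset G}
      & forall w x, w \in G -> {in s, forall C, ~ C x} -> p x w = x].
Proof.
elim: s => [_ _|C s IH /=/andP[Cs us] cs].
  exists 1%G; rewrite big_nil; split=> // w x /set1P-> _; exact: tact1.
have [|G [sG GP Gfix]] := IH us; first by move=> D Ds; apply: cs; rewrite inE Ds orbT.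
have cC : comps C by apply: cs; rewrite mem_head.
have GC w x : w \in G -> C x -> p x w = x.
  move=> wG Cx; apply: (Gfix w) => // D Ds Dx; move/negP: Cs; apply.
  by rewrite (comps_eq cC _ Cx Dx) //; apply: cs; rewrite inE Ds orbT.
exists (W_ C <*> G)%G; rewrite big_cons sG; split.
- rewrite dprodEY //.
    apply/fintype.subsetP => b bG; apply/centP => a aC; apply/commute_sym.
    apply: (disjoint_support_commute p_faithful (A := C)) => x.
      exact: comp_group_fix.
    exact: GC.
  apply/trivgP/fintype.subsetP => w /setIP[wC wG]; apply/set1P/p_faithful => x.
  have [Cx|nCx] := pselect (C x); first exact: GC.
  exact: comp_group_fix wC nCx.
- move=> D; rewrite inE => /predU1P[->|/GP]; first exact: joing_subl.
  by move=> h; apply: (fintype.subset_trans h); apply: joing_subr.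
move=> w x; rewrite /= joingE; move: w.
apply: (@gen_ind _ _ (fun w => {in C :: s, forall C, ~ C x} -> p x w = x)) => [_|a b ha hb n|w].
- exact: tact1.
- by rewrite tactM ha // hb.
rewrite inE => /orP[wC|wG] n; first by apply: comp_group_fix wC (n C (mem_head _ _)).
by apply: Gfix => // D Ds; apply: n; rewrite inE Ds orbT.
Qed.

Lemma dprod_comps : \big[dprod/1%g]_(C \in comps) (W_ C : {set W}) = [set: W]%SET.
Proof.
(* The product over [comps] runs over its finite support, the components with nontrivial group; any
   generator other than 1 lies in one of these. *)
set s := finite_support _ _ _.
have sE C : C \in s = (C \in comps `&` (fun C => W_ C : {set W}) @^-1` [set~ 1%g]).
  rewrite in_finite_support //; apply: sub_finite_set finite_nontrivial_comps.
  move=> D [cD /= nt]; split=> // e; exact/nt/(congr1 (@gval W) e).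
have [||G [-> sG _]] := @bigdprod_comps s; first exact: finite_support_uniq.
  by move=> C; rewrite sE inE => -[].
apply/eqP; rewrite finset.eqEsubset finset.subsetT /= -S_gen gen_subG; apply/fintype.subsetP => t tS.
have [C cC tC] := S_comp_group tS.
have [t1|/eqP t1] := eqVneq t 1%g; first by rewrite t1 group1.
apply: (fintype.subsetP (sG C _) _ tC); rewrite sE inE; split=> //= e.
by have : t \in (1%g : {set W}) by [rewrite -e]; move/set1P.
Qed.

(** [theta] restricts the action to [C], numbered by [x]. It is injective because [W_ C] fixes
    everything outside [C], and surjective because transpositions along the paths of [C] yield all
    transpositions. *)
Lemma comp_group_perm C : exists (x : 'I_(nverts C) -> V)
    (theta : {morphism W_ C >-> 'S_(nverts C)}), comps C ->
  [/\ set_bij setT C x, isom (W_ C) [set: 'S_(nverts C)]%SET theta,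
      forall s i j, edge s (x i) (x j) -> theta s = tperm i j
    & forall w i, w \in W_ C -> x (theta w i) = p (x i) w].
Proof.
have [cC|ncC] := pselect (comps C); last first.
  (* Placeholder values, making [x] and [theta] total in [C]. *)
  by exists (fun=> 0), [morphism of trivm (W_ C)].
have [x xP] := nverts_enum (comps_finite cC); have [xC xI xS] := xP.
have {}xI : injective x by move=> i j; apply: xI; rewrite inE.
have {}xC i : C (x i) by apply: xC.
have /choice[th thP] : forall w, exists s : 'S_(nverts C),
    forall i, x (s i) = p (x i) w.
  move=> w; have /choice[f fP] : forall i, exists j, x j = p (x i) w.
    by move=> i; have [j _ <-] := xS _ (comps_stable w cC (xC i)); exists j.
  have fI : injective f.
    by move=> i j fij; apply: xI; apply: (@tact_inj _ _ p w); rewrite -!fP fij.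
  by exists (perm fI) => i; rewrite permE.
have thM : {in W_ C &, {morph th : a b / (a * b)%g}}.
  by move=> a b _ _; apply/permP => i; apply: xI; rewrite permM !thP tactM.
have th_edge s i j : edge s (x i) (x j) -> th s = tperm i j.
  move=> /edgeP[_ _ ij ji h]; apply/permP => l; apply: (xI); rewrite thP.
  by case: tpermP => [->|->|li lj] //; apply: h => /xI.
exists x, (Morphism thM) => cC'; split=> //; apply/isomP; split.
  apply/fintype.subsetP => w /morphpreP[wC /set1P /= w1]; apply/set1P/p_faithful => y.
  have [/xS[i _ <-]|nCy] := pselect (C y); last exact: comp_group_fix wC nCy.
  by rewrite -thP w1 perm1.
apply/eqP; rewrite finset.eqEsubset finset.subsetT /=.
pose G := (Morphism thM @* W_ C)%G; suff GT i j : tperm i j \in G by exact: (tperm_generate GT).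
have [q qP qj] : exists2 q, path adjacent (x i) q & last (x i) q = x j.
  by have := xC j; rewrite (compsE cC (xC i)).
elim: q i qP qj => [i _ /xI ->|z q IH i /=]; first by rewrite tperm1 group1.
move=> /andP[/adjacentP[s e] qP].
have [k _ zk] := xS _ (comps_edge cC e (xC i)); rewrite -{z}zk in e qP *.
move=> /(IH k qP) kj; have ik : tperm i k \in G.
  rewrite -(th_edge s i k e); apply: (mem_morphim (Morphism thM)).
    exact: (edge_comp_group cC e (xC i)).
  exact: (edge_comp_group cC e (xC i)).
have [<-//|kj'] := eqVneq k j; have [<-|ij] := eqVneq i j.
  by rewrite tperm1 group1.
(* The first edge of the path gives [tperm i k], the rest gives [tperm k j] by induction, and
   conjugation combines them. *)
have -> : tperm i j = (tperm i k ^ tperm k j)%g; last by rewrite groupJ.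
have ki : k != i by apply: contra_not_neq (_ : x i <> x k) => [->|]; case: e.
by rewrite tpermJ tpermL tpermD // eq_sym.
Qed.

End TranspositionGroups.

(** * Decomposition of the module *)

Section DirectSumOfBlocks.
Variables (K : comNzRingType) (V : lmodType K) (X : set V) (r : V -> V).
Variable (g : V -> V -> K).
Hypothesis g_linear : forall y, scalar (g y).
Hypothesis g_delta : forall x y, X x -> X y -> g y (r x) = (y == x)%:R.
Hypothesis expand : forall v, exists s,
  [/\ uniq s, forall y, y \in s -> X y & v = \sum_(y <- s) g y v *: r y].
Variables (blocks : set (set V)) (n : set V -> nat) (x : forall C, 'I_(n C) -> V).
Hypothesis blocks_sub : forall C y, blocks C -> C y -> X y.
Hypothesis blocks_cover : forall y, X y -> exists2 C, blocks C & C y.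
Hypothesis blocks_eq : forall C D y, blocks C -> blocks D -> C y -> D y -> C = D.
Hypothesis x_bij : forall C, blocks C -> set_bij setT C (@x C).

Let M := dsum (fun C : blocks => 'rV[K]_(n (\val C))).

Let gL y : {scalar V} :=
  HB.pack (g y) (GRing.isLinear.Build _ _ _ _ (g y) (g_linear y)).

Let g_sum y (s : seq V) (c : V -> K) : X y -> uniq s -> (forall z, z \in s -> X z) ->
  g y (\sum_(z <- s) c z *: r z) = if y \in s then c y else 0.
Proof.
move=> Xy us sX; rewrite -[LHS]/(gL y _) linear_sum big_seq.
under eq_bigr => z /sX Xz do rewrite scalarZ /= g_delta //.
rewrite -big_seq; case: ifP => ys.
  rewrite (bigD1_seq y) //= eqxx mulr1 big1 ?addr0 // => z /negPf zy.
  by rewrite eq_sym zy mulr0.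
rewrite big_seq big1 // => z zs; case: eqP => [yz|_]; last by rewrite mulr0.
by rewrite yz zs in ys.
Qed.

Let xC C i : blocks C -> C (x (C := C) i).
Proof. by move=> /x_bij[h _ _]; apply: h. Qed.

Let blockP (C : blocks) : blocks (\val C). Proof. exact: set_valP. Qed.

Let block_eq (C D : blocks) y : \val C y -> \val D y -> C = D.
Proof. by move=> Cy Dy; apply/val_inj/(blocks_eq _ _ Cy Dy). Qed.

Let row_coord v (C : blocks) : 'rV[K]_(n (\val C)) := \row_i g (x i) v.

(** The expansion of [v] involves finitely many basis vectors, each belonging to a single block. *)
Fact row_coord_finite v : `[< finite_set [set C | row_coord v C <> 0] >].
Proof.
apply/asboolP; have [s [us sX vE]] := expand v.
have /choice[F FP] : forall y, exists D, forall C, blocks C -> C y -> C = D.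
  move=> y; have [[D [cD Dy]]|no] := pselect (exists D, blocks D /\ D y).
    by exists D => C cC Cy; apply: blocks_eq Cy Dy.
  by exists set0 => C cC Cy; case: no; exists C.
apply: (@sub_finite_set _ _ (\val @^-1` (F @` [set` s]))) => [C /= nz|].
  have [i /eqP nzi] : exists i, row_coord v C 0 i <> 0.
    by apply: contra_notP nz => /forallNP h; apply/rowP => i; rewrite [RHS]mxE;
    apply: contrapT; apply: h.
  have Ci := xC i (blockP C).
  exists (x i); last by apply/esym; apply: FP (blockP C) Ci.
  move: nzi; rewrite mxE {1}vE g_sum //; last exact: blocks_sub Ci.
  by case: ifP => //; rewrite eqxx.
apply: finite_preimage => [C D _ _|]; first exact: val_inj.
by apply: finite_image; apply: finite_seq.
Qed.

Let Phi v : M * 'rV[K]_0 := (DSum (row_coord_finite v), 0).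

Fact Phi_linear : linear Phi.
Proof.
move=> a u v; congr (_, _); last by rewrite [RHS]thinmx0.
by apply: (@dsumP K) => C; apply/rowP => i; rewrite !mxE g_linear.
Qed.

(** Injectivity: the blocks cover [X], so all coordinates are recorded. Surjectivity: a family of
    finite support involves finitely many finite blocks, so it comes from a finite combination. *)
Lemma coord_dsum_iso : exists f : {linear V -> (M * 'rV[K]_0)%type},
  bijective f /\ forall v (C : blocks) i, (f v).1 C 0 i = g (x i) v.
Proof.
pose f : {linear V -> (M * 'rV[K]_0)%type} :=
  HB.pack Phi (GRing.isLinear.Build _ _ _ _ Phi Phi_linear).
have fE v (C : blocks) i : (f v).1 C 0 i = g (x i) v by rewrite mxE.
exists f; split=> //.
have f_inj : injective f.
  apply: raddf_inj => v fv0; have [s [us sX ->]] := expand v.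
  rewrite big_seq big1 // => y /sX Xy; have [C bC Cy] := blocks_cover Xy.
  have [_ _ /(_ y Cy)[i _ <-]] := x_bij bC.
  pose C' : blocks := SigSub (mem_set bC).
  by have := fE v C' i; rewrite fv0 /= mxE => <-; rewrite scale0r.
suff /choice[f' f'P] : forall d, exists v, f v = d.
  by exists f' => d //; apply: f_inj; rewrite f'P.
move=> [d z].
have /choice[h hP] : forall y, exists a, forall (C : blocks) i, x i = y -> a = d C 0 i.
  move=> y; have [[C [i xi]]|no] := pselect (exists (C : blocks) i, x (C := \val C) i = y).
    exists (d C 0 i) => D j xj.
    have CD : C = D.
      by apply: (@block_eq C D y); [rewrite -xi|rewrite -xj]; apply: xC; exact: blockP.
    (* The type of an index depends on its block; eliminating [C = D] puts [i] and [j] in the same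
       ordinal type. *)
    case: _ / CD j xj => j; rewrite -xi; have [_ xI _] := x_bij (blockP C).
    by move=> /xI ->; rewrite ?inE.
  by exists 0 => C i xi; case: no; exists C, i.
pose A := \bigcup_(C in [set C | d C <> 0]) \val C.
have fA : finite_set A.
  apply: bigcup_finite => [|C _]; first exact: dsum_finite.
  have [_ _ xS] := x_bij (blockP C).
  apply: (@sub_finite_set _ _ (x (C := \val C) @` setT)) => [y /xS //|].
  exact/finite_image/finite_finset.
pose s := enum_fset (fset_set A).
have sA y : (y \in s) = (y \in A) by exact: (in_fset_set fA).
exists (\sum_(y <- s) h y *: r y); rewrite [f _]surjective_pairing; congr (_, _).
  apply: (@dsumP K) => C; apply/rowP => i; rewrite fE g_sum ?fset_uniq //.
  - case: ifPn => [_|]; first exact: hP.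
    rewrite sA => /negP nA; have [->|/eqP dC] := eqVneq (d C) 0; first by rewrite mxE.
    by case: nA; rewrite inE; exists C => //; apply: xC; exact: blockP.
  - exact: blocks_sub (xC _ (blockP C)).
  - by move=> y; rewrite sA inE => -[C' _ /blocks_sub]; apply; apply: blockP.
by rewrite [LHS]thinmx0 [RHS]thinmx0.
Qed.

End DirectSumOfBlocks.

(** * Realizations that preserve an orthant *)

Lemma subring_in_sub (R : realType) (KK : {pred R}) (K : GRing.SubComNzRing.type KK)
    (k : {pred R}) : subring_closed k ->
  [/\ 0 \in @in_sub R KK K k, 1 \in @in_sub R KK K k,
      {in @in_sub R KK K k &, forall a b, a - b \in @in_sub R KK K k},
      {in @in_sub R KK K k &, forall a b, a + b \in @in_sub R KK K k}
    & {in @in_sub R KK K k &, forall a b, a * b \in @in_sub R KK K k}].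
Proof.
move=> [k1 kB kM].
have k0 : 0 \in k by rewrite -(subrr 1) kB.
split; rewrite ?[_ \in _]inE ?rmorph0 ?rmorph1 // => a b; rewrite !inE.
- by rewrite rmorphB; apply: kB.
- move=> ka kb; rewrite rmorphD -[X in _ + X]opprK kB // -[- _]add0r; exact: kB.
- by rewrite rmorphM; apply: kM.
Qed.

Theorem theorem2p2 (R : realType) (KK : {pred R}) (K : GRing.SubComNzRing.type KK)
    (k : {pred R}) (k_subring : subring_closed k) (k_sub : {subset k <= KK})
    (W : finGroupType) (S : {set W}) (WS : coxeter_system S)
    (V : lmodType K) (rho : realization S V)
    (rho_faithful : faithful_action (waction rho))
    (X : set V) (orthant : preserves_orthant (waction rho) k X) :
  let comps := components (waction rho) S X in
  let W_ := comp_group (waction rho) S X in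
  let pr_ := comp_proj (waction rho) S X in
  exists (x : forall C : set V, 'I_(nverts C) -> V)
         (theta : forall C : set V, {morphism W_ C >-> 'S_(nverts C)}),
  [/\ forall C, comps C ->
        [/\ finite_set C,
            set_bij setT C (x C),
            isom (W_ C) [set: 'S_(nverts C)]%SET (theta C)
          & forall s i j, edge (waction rho) S X s (x C i) (x C j) ->
              theta C s = tperm i j],
      finite_set [set C | comps C /\ W_ C <> 1%G],
      \big[dprod/1%g]_(C \in comps) (W_ C : {set W}) = [set: W]%SET
    & exists (Z : lmodType K)
             (Phi : {linear V -> (dsum (fun C : comps => 'rV[K]_(nverts (\val C))) * Z)%type}),
        bijective Phi /\
        forall (w : W) (v : V),
          (forall C : comps, (Phi (waction rho v w)).1 C =
             (Phi v).1 C *m perm_mx (theta (\val C) (pr_ (\val C) w))) /\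
          (Phi (waction rho v w)).2 = (Phi v).2].
Proof.
move=> comps W_ pr_; have [k0 k1 kB kD kM] := subring_in_sub K k_subring.
have [S2 S_gen _] := WS.
case: orthant => L [[[B [bB LE]] _] bX cone].
have bXK : is_basis predT X setT := span_basis_basis k0 k1 kB kD kM bB LE bX.
have [f [fl fc fd]] := basis_coord bXK.
have [to_linear reflection] : (forall w, linear ((waction rho)^~ w)) /\
    {in S, forall s, exists (c : V -> K) a, forall v, waction rho v s = v - c v *: a}.
  case: (rho) => rt crt to h1 h2 h3 tol tos; split=> //= s sS.
  by exists (crt s), (rt s); apply: tos.
(* The image of [x] stays in the cone, and by uniqueness its nonnegative coefficients there are its
   [K]-coordinates. *)
have to_ge0 w x y : X x -> 0 <= \val (f y (waction rho x w)).
  move=> Xx; have : lin_span (@in_sub_nneg R KK K k) X (waction rho x w).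
    apply: cone; exists [:: x], (fun=> 1); split=> // [z|]; last first.
      by rewrite big_seq1 scale1r.
    rewrite inE => /eqP ->; split=> //; rewrite inE rmorph1 ler01 andbT.
    by case: k_subring.
  move=> /lin_span_coordinates[|c cw].
    by rewrite inE rmorph0 lexx andbT; case: k_subring => k1' kB' _; rewrite -(subrr 1) kB'.
  have -> : f y (waction rho x w) = c y.
    exact: (@coordinates_unique _ _ predT _ _ _ _ _ bXK.1 (fc _) (coordinatesW _ cw)).
  by case: cw => /(_ y); rewrite inE => /andP[].
have [p [r [g [pX p_out to_r [gl gd expand]]]]] :=
  permuted_basis fl fc fd to_linear to_ge0.
have pX1 w x : X x -> X (p x w) by move=> /(pX w)[].
have pX2 w x : X x -> (p x w = x <-> waction rho x w = x) by move=> /(pX w)[].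
have p_faithful : faithful_action p.
  move=> w pw; apply: rho_faithful.
  exact: (fixes_basis_trivial to_linear to_r expand) (fun x _ => pw x).
have S_tr : {in S, forall s, exists x y,
    [/\ X x, X y, x <> y & X `&` [set z | p z s <> z] = [set x; y]]}.
  move=> s sS; have [c [a sE]] := reflection s sS.
  apply: (reflection_transposes to_linear pX1 to_r gl gd expand (S2 s sS) _ sE).
  (* A generator acting trivially would be 1 by faithfulness, against its order 2. *)
  apply/existsNP => /rho_faithful s1.
  by have := S2 s sS; rewrite s1 order1.
(* The types of [x] and [theta] depend on [C], so the witnesses are extracted by [cid] for each
   [C]. *)
have cP C := cid (comp_group_perm pX1 pX2 p_out p_faithful S_tr S_gen C).
pose x C := projT1 (cP C).
have tP C := cid (projT2 (cP C)).
pose theta C := projT1 (tP C).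
have xtP C := projT2 (tP C).
have x_bij C : comps C -> set_bij setT C (x C) by move=> /xtP[].
exists x, theta; split.
- move=> C cC; have [? ? h ?] := xtP C cC; split=> //.
  exact: (comps_finite pX1 pX2 p_out cC).
- exact: (finite_nontrivial_comps S pX1 pX2 p_out).
- exact: (dprod_comps pX1 pX2 p_out p_faithful S_tr S_gen).
have sub C y : comps C -> C y -> X y by apply: (comps_sub pX1 pX2 p_out).
have eqC C D y : comps C -> comps D -> C y -> D y -> C = D.
  exact: comps_eq.
have cover y : X y -> exists2 C, comps C & C y by apply: comps_cover.
have [Phi [Phi_bij PhiE]] := coord_dsum_iso gl gd expand sub cover eqC x_bij.
exists 'rV[K]_0, Phi; split=> // w v; split=> [C|]; last by rewrite [LHS]thinmx0 [RHS]thinmx0.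
have cC : comps (\val C) by apply: set_valP.
have [wC wE] := comp_projP pX1 pX2 p_out p_faithful S_tr S_gen w cC.
have [[xC _ _] _ _ th] := xtP _ cC.
apply/rowP => j; set s := theta _ _.
(* Multiplying by [perm_mx s] moves column [s^-1 j] to column [j]. It remains that [w] sends the
   vertex numbered [s^-1 j] to the one numbered [j], and on [C] it acts as its projection. *)
rewrite -[s]invgK -col_permE mxE !PhiE -[RHS](basis_coord_act to_linear pX1 to_r gl gd expand w).
  congr (g _ _); rewrite -wE; last exact: xC.
  by rewrite /x -th // -permM mulVg perm1.
exact: sub cC (xC _ _).
Qed.
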